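(* Let $b:\mathbb{R}^d\to\mathbb{R}^d$ and $\sigma:\mathbb{R}^d\to\mathbb{R}^{d\times n}$ satisfy conditions (A1)-(A5) listed in the context, and let $\{X(t)\}_{t\ge0}$ be the diffusion process with transition kernel $p(t,x,\mathrm{d}y)$ determined by the stochastic differential equation $$\mathrm{d}X(x,t)=b(X(x,t))\,\mathrm{d}t+\sigma(X(x,t))\,\mathrm{d}B(t),\qquad X(x,0)=x\in\mathbb{R}^d.$$ If $\{X(t)\}_{t\ge0}$ is uniformly ergodic, then for any subordinator $\{S(t)\}_{t\ge0}$ independent of $\{X(t)\}_{t\ge0}$ the subordinate process $X^S(t):=X(S(t))$, $t\ge0$, is also uniformly ergodic.
   Context: Notation: $B_r(x)$ is the open ball of radius $r>0$ around $x\in\mathbb{R}^d$, $B_r^c(x)$ is its complement, $\|M\|_{\mathrm{HS}}^2:=\mathrm{Tr}\,MM^T$ is the squared Hilbert-Schmidt norm of a real matrix $M$, and $\{B(t)\}_{t\ge0}$ is a standard $n$-dimensional Brownian motion on a stochastic basis $(\Omega,\mathcal{F},\{\mathcal{F}(t)\}_{t\ge0},\mathbb{P})$ satisfying the usual conditions. Conditions on the coefficients: (A1) For any $r>0$, $\sup_{x\in B_r(0)}(|b(x)|+\|\sigma(x)\|_{\mathrm{HS}})<\infty$. (A2) For any $r>0$ there exists $\Gamma_r>0$ such that for all $x,y\in B_r(0)$, $2\langle x-y,b(x)-b(y)\rangle+\|\sigma(x)-\sigma(y)\|_{\mathrm{HS}}^2\le\Gamma_r|x-y|^2$. (A3) There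 exists $\Gamma>0$ such that for all $x\in\mathbb{R}^d$, $2\langle x,b(x)\rangle+\|\sigma(x)\|_{\mathrm{HS}}^2\le\Gamma(1+|x|^2)$. (A4) There exist $x_0\in\mathbb{R}^d$ and $r_0,\alpha,D,\delta>0$ such that for all $x,y\in B_{r_0}(x_0)$, $|b(x)-b(y)|+\|\sigma(x)\sigma(x)^T-\sigma(y)\sigma(y)^T\|_{\mathrm{HS}}\le D|x-y|^\alpha$ and $\langle\sigma(x)^Ty,\sigma(x)^Ty\rangle\ge\delta|y|^2$. (A5) For $x_0\in\mathbb{R}^d$ and $r_0>0$ from (A4), $\sigma(x)\sigma(x)^T$ is positive definite on $B_{r_0}^c(x_0)$. Under (A1)-(A3), for every $x\in\mathbb{R}^d$ the SDE admits a unique strong non-explosive solution $\{X(x,t)\}_{t\ge0}$, which is a strong Markov process with continuous sample paths and transition kernel $p(t,x,\mathrm{d}y)=\mathbb{P}(X(x,t)\in\mathrm{d}y)$. $\{X(t)\}_{t\ge0}$ denotes the canonical (path-space) version of this Markov process, with laws $\mathbb{P}^x$, $x\in\mathbb{R}^d$. A subordinator $\{S(t)\}_{t\ge0}$ is a non-decreasing Lévy process on $[0,\infty)$; write $\mu_t(\mathrm{d}s):=\mathbb{P}(S(t)\in\mathrm{d}s)$. The subordinate process $\{X^S(t)\}_{t\ge0}$ (subordination in the sense of Bochner) is a Markov process with transition kernel $p^S(t,x,\mathrm{d}y)=\int_{[0,\infty)}p(s,x,\mathrm{d}y)\,\mu_t(\mathrm{d}s)$. A Markov process on $\mathbb{R}^d$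 with transition kernel $q(t,x,\mathrm{d}y)$ is uniformly ergodic if it possesses an invariant probability measure $\pi$ on $\mathcal{B}(\mathbb{R}^d)$, the Borel $\sigma$-algebra (i.e. $\int_{\mathbb{R}^d}q(t,x,\mathrm{d}y)\,\pi(\mathrm{d}x)=\pi(\mathrm{d}y)$ for all $t>0$), such that $\lim_{t\to\infty}\sup_{x\in\mathbb{R}^d}\|q(t,x,\mathrm{d}y)-\pi(\mathrm{d}y)\|_{\mathrm{TV}}=0$, where $\|\mu\|_{\mathrm{TV}}:=\sup_{B\in\mathcal{B}(\mathbb{R}^d)}|\mu(B)|$ for a signed measure $\mu$ on $\mathcal{B}(\mathbb{R}^d)$.
   Formalization: The subordinator is additionally assumed not to be almost surely identically zero; for S = 0 the subordinate process stays at its starting point and the claim as written fails. *)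

(* Defs.v *)
From HB Require Import structures.
From mathcomp Require Import all_boot all_order all_algebra.
From mathcomp Require Import all_classical all_reals all_analysis.

Set Implicit Arguments.
Unset Strict Implicit.
Unset Printing Implicit Defensive.

Import Order.TTheory GRing.Theory Num.Theory.
Import numFieldNormedType.Exports.

Local Open Scope classical_set_scope.
Local Open Scope ring_scope.

(* T with its Borel sigma-algebra; the carrier is convertible to T. *)
Notation borel T := (g_sigma_algebraType (@open T)).

(* R^d is 'cV[R]_d.  Its MathComp topology is the usual one, but the library
   norm `|x| on matrices is the sup norm, so Euclidean and Hilbert-Schmidt
   norms are defined here. *)
Section euclidean.
Context {R : realType}.

Definition dot {d : nat} (x y : 'cV[R]_d) : R := (x^T *m y) 0 0.

Definition enorm {d : nat} (x : 'cV[R]_d) : R := Num.sqrt (dot x x).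

Definition hsnorm {m n : nat} (M : 'M[R]_(m, n)) : R :=
  Num.sqrt (\tr (M *m M^T)).

Definition eball {d : nat} (x : 'cV[R]_d) (r : R) : set 'cV[R]_d :=
  [set y | enorm (y - x) < r].

Definition posdef {d : nat} (A : 'M[R]_d) : Prop :=
  A^T = A /\ forall v : 'cV[R]_d, v != 0 -> 0 < dot v (A *m v).

End euclidean.

Section coefficients.
Context {R : realType} {d n : nat}.
Variables (b : 'cV[R]_d -> 'cV[R]_d) (sigma : 'cV[R]_d -> 'M[R]_(d, n)).

Definition condA1 : Prop := forall r : R, 0 < r ->
  has_ubound [set enorm (b x) + hsnorm (sigma x) | x in eball 0 r].

Definition condA2 : Prop := forall r : R, 0 < r ->
  exists2 Gamma : R, 0 < Gamma &
    forall x y, eball 0 r x -> eball 0 r y ->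
      2 * dot (x - y) (b x - b y) + hsnorm (sigma x - sigma y) ^+ 2
        <= Gamma * enorm (x - y) ^+ 2.

Definition condA3 : Prop := exists2 Gamma : R, 0 < Gamma &
  forall x, 2 * dot x (b x) + hsnorm (sigma x) ^+ 2
    <= Gamma * (1 + enorm x ^+ 2).

(* x0 and r0 are parameters because A5 refers to the ones of A4. *)
Definition condA4 (x0 : 'cV[R]_d) (r0 : R) : Prop :=
  0 < r0 /\
  exists alpha D delta : R, [/\ 0 < alpha, 0 < D, 0 < delta &
    forall x y, eball x0 r0 x -> eball x0 r0 y ->
      enorm (b x - b y)
        + hsnorm (sigma x *m (sigma x)^T - sigma y *m (sigma y)^T)
          <= D * enorm (x - y) `^ alpha
      /\ dot ((sigma x)^T *m y) ((sigma x)^T *m y) >= delta * enorm y ^+ 2].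

Definition condA5 (x0 : 'cV[R]_d) (r0 : R) : Prop :=
  forall x, (~` eball x0 r0) x -> posdef (sigma x *m (sigma x)^T).

End coefficients.

(* A process is a map R -> Omega -> E, of which only the times t >= 0 matter. *)
Section processes.
Context {R : realType} {disp : measure_display} {Omega : measurableType disp}.
Variable P : probability Omega R.

Definition indep_systems (G H : set (set Omega)) : Prop :=
  forall A C, G A -> H C -> P (A `&` C) = (P A * P C)%E.

(* sigma-algebra generated by the Y t, t in T *)
Definition process_sigma {disp' : measure_display} {E : measurableType disp'}
    (T : set R) (Y : R -> Omega -> E) : set (set Omega) :=
  <<s [set C | exists t A, [/\ T t, measurable A & C = Y t @^-1` A]] >>.

Definition indep_processes
    {d1 d2 : measure_display} {E1 : measurableType d1} {E2 : measurableType d2}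
    (Y : R -> Omega -> E1) (Z : R -> Omega -> E2) : Prop :=
  indep_systems (process_sigma [set t | 0 <= t] Y)
                (process_sigma [set t | 0 <= t] Z).

(* Meaningful when the events [set w | e%:E <= u k w] are measurable, which is
   the case wherever it is used below. *)
Definition cvg_in_probability_to0 (u : nat -> Omega -> \bar R) : Prop :=
  forall e : R, 0 < e -> P [set w | (e%:E <= u k w)%E] @[k --> \oo] --> 0%E.

Section stochastic_basis.
Variable F : R -> set (set Omega).

Record usual_filtration : Prop := {
  filtration_sigma : forall t : R, 0 <= t -> sigma_algebra setT (F t) ;
  filtration_sub : forall t : R, 0 <= t -> F t `<=` measurable ;
  filtration_le : forall s t : R, 0 <= s -> s <= t -> F s `<=` F t ;
  filtration_rcont : forall t : R, 0 <= t -> \bigcap_(s in [set s | t < s]) F s = F t ;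
  filtration_complete : forall N, P.-negligible N -> F 0 N }.

Definition adapted {disp' : measure_display} {E : measurableType disp'}
    (Y : R -> Omega -> E) : Prop :=
  forall t : R, 0 <= t -> forall A, measurable A -> F t (Y t @^-1` A).

Definition progressive {disp' : measure_display} {E : measurableType disp'}
    (Y : R -> Omega -> E) : Prop :=
  forall t : R, 0 <= t ->
    measurable_fun
      (`[0, t] `*` [set: g_sigma_algebraType (F t)]
         : set (measurableTypeR R * g_sigma_algebraType (F t)))
      (fun z => Y z.1 z.2).

Record brownian_motion {n : nat} (B : R -> Omega -> 'cV[R]_n) : Prop := {
  bm_adapted : adapted (B : R -> Omega -> borel 'cV[R]_n) ;
  bm_cont : forall w, {within `[0, +oo[, continuous (B ^~ w)} ;
  bm_0 : \forall w \ae P, B 0 w = 0 ;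
  bm_indep : forall s t : R, 0 <= s -> s < t ->
    indep_systems (F s)
      (preimage_set_system setT (fun w => B t w - B s w : borel 'cV[R]_n)
         measurable) ;
  (* B t - B s has law N(0, (t - s) I_n); normal_prob takes the standard
     deviation *)
  bm_law : forall s t : R, 0 <= s -> s < t ->
    forall A : 'I_n -> set R, (forall i, measurable (A i)) ->
      P [set w | forall i, A i (B t w i 0 - B s w i 0)] =
        (\prod_(i < n) fine (normal_prob 0 (Num.sqrt (t - s)) (A i)))%:E }.

Section ito.
Context {d n : nat}.
Variable B : R -> Omega -> 'cV[R]_n.

(* the simple process \sum_(i < size) 1_(time i, time i.+1] * val i *)
Record simple_data := SimpleData {
  sp_size : nat ;
  sp_time : nat -> R ;
  sp_val : nat -> Omega -> 'M[R]_(d, n) }.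

Record is_simple (h : simple_data) : Prop := {
  simple_time0 : 0 <= sp_time h 0 ;
  simple_time_le : {homo sp_time h : i j / (i <= j)%N >-> i <= j} ;
  simple_val_meas : forall i, (i < sp_size h)%N ->
    forall A : set (borel 'M[R]_(d, n)), measurable A ->
      F (sp_time h i) (sp_val h i @^-1` A) ;
  simple_val_bounded : exists M : R, forall i w, (i < sp_size h)%N ->
    hsnorm (sp_val h i w) <= M }.

Definition simple_process (h : simple_data) (t : R) (w : Omega) : 'M[R]_(d, n) :=
  \sum_(i < sp_size h)
    (\1_`]sp_time h i, sp_time h i.+1] t : R) *: sp_val h i w.

Definition simple_integral (h : simple_data) (t : R) (w : Omega) : 'cV[R]_d :=
  \sum_(i < sp_size h)
    sp_val h i w *m (B (Num.min (sp_time h i.+1) t) w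
                     - B (Num.min (sp_time h i) t) w).

(* I is (a continuous version of) the Ito integral process \int_0^t H dB, for
   H progressively measurable and almost surely locally square integrable:
   I t is the limit in probability of the integrals of simple processes h k
   such that \int_0^t |h k - H|^2 ds tends to 0 in probability. *)
Record is_ito_integral (H : R -> Omega -> 'M[R]_(d, n))
    (I : R -> Omega -> 'cV[R]_d) : Prop := {
  ito_progressive : progressive (H : R -> Omega -> borel 'M[R]_(d, n)) ;
  ito_integrand : \forall w \ae P, forall t : R, 0 <= t ->
    (\int[lebesgue_measure]_(s in `[0%R, t]) (hsnorm (H s w) ^+ 2)%:E < +oo)%E ;
  ito_adapted : adapted (I : R -> Omega -> borel 'cV[R]_d) ;
  ito_cont : \forall w \ae P, {within `[0, +oo[, continuous (I ^~ w)} ;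
  ito_approx : exists h : nat -> simple_data,
    (forall k, is_simple (h k)) /\
    forall t : R, 0 <= t ->
      cvg_in_probability_to0 (fun k w =>
        \int[lebesgue_measure]_(s in `[0%R, t])
           (hsnorm (simple_process (h k) s w - H s w) ^+ 2)%:E)%E /\
      cvg_in_probability_to0 (fun k w =>
        (enorm (simple_integral (h k) t w - I t w))%:E) }.

(* Y solves dY = b(Y) dt + sigma(Y) dB, Y(0) = x, globally in time; sigma(Y) dB
   is an Ito integral and b(Y) dt a pathwise Lebesgue integral. *)
Record sde_solution (b : 'cV[R]_d -> 'cV[R]_d)
    (sigma : 'cV[R]_d -> 'M[R]_(d, n)) (x : 'cV[R]_d)
    (Y : R -> Omega -> 'cV[R]_d) : Prop := {
  sol_adapted : adapted (Y : R -> Omega -> borel 'cV[R]_d) ;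
  sol_cont : forall w, {within `[0, +oo[, continuous (Y ^~ w)} ;
  sol_drift : \forall w \ae P, forall (t : R) i, 0 <= t ->
    lebesgue_measure.-integrable `[0, t] (fun s => (b (Y s w) i 0)%:E) ;
  sol_eq : exists2 I : R -> Omega -> 'cV[R]_d,
    is_ito_integral (fun s w => sigma (Y s w)) I &
    \forall w \ae P, forall t : R, 0 <= t ->
      Y t w = x + (\col_i \int[lebesgue_measure]_(s in `[0%R, t]) b (Y s w) i 0)
                + I t w }.

End ito.
End stochastic_basis.

(* Non-decreasing Levy process with values in [0, +oo[; left limits of the
   paths exist by monotonicity. *)
Record subordinator (S : R -> Omega -> R) : Prop := {
  sub_meas : forall t : R, 0 <= t -> measurable_fun setT (S t) ;
  sub_ge0 : forall t w, 0 <= t -> 0 <= S t w ;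
  sub_0 : \forall w \ae P, S 0 w = 0 ;
  sub_nondecreasing : \forall w \ae P, forall s t : R, 0 <= s -> s <= t ->
    S s w <= S t w ;
  sub_rcont : \forall w \ae P, forall t : R, 0 <= t -> S r w @[r --> t^'+] --> S t w ;
  sub_indep : forall s t : R, 0 <= s -> s <= t ->
    indep_systems (process_sigma [set u | 0 <= u <= s] S)
      (preimage_set_system setT (fun w => S t w - S s w) measurable) ;
  sub_stationary : forall s t : R, 0 <= s -> 0 <= t ->
    forall A, measurable A ->
      P [set w | A (S (s + t) w - S s w)] = P [set w | A (S t w)] }.

(* Excludes S = 0, for which X (S t) = X 0 never forgets its starting point. *)
Definition nonzero_process (S : R -> Omega -> R) : Prop :=
  exists2 t : R, 0 <= t & ~ (\forall w \ae P, S t w = 0).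

(* For a family Y x of processes indexed by the starting point x:
   the kernel q(t, x, A) = P(Y x t \in A). *)
Definition process_kernel {d : nat} (Y : 'cV[R]_d -> R -> Omega -> 'cV[R]_d)
    (t : R) (x : borel 'cV[R]_d) (A : set (borel 'cV[R]_d)) : \bar R :=
  P [set w | A (Y x t w)].

(* If S is independent of X x, then X x (S t) has law
   \int P(X x s \in dy) P(S t \in ds), i.e. the kernel of [subordinate X S] is
   the Bochner-subordinated kernel. *)
Definition subordinate {d : nat} (X : 'cV[R]_d -> R -> Omega -> 'cV[R]_d)
    (S : R -> Omega -> R) : 'cV[R]_d -> R -> Omega -> 'cV[R]_d :=
  fun x t w => X x (S t w) w.

End processes.

Section ergodicity.
Context {R : realType} {d : nat}.

Definition tv_dist (mu nu : set (borel 'cV[R]_d) -> \bar R) : \bar R :=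
  ereal_sup [set `|mu A - nu A|%E | A in measurable].

Definition uniformly_ergodic
    (q : R -> borel 'cV[R]_d -> set (borel 'cV[R]_d) -> \bar R) : Prop :=
  exists pi : probability (borel 'cV[R]_d) R,
    (forall t : R, 0 < t -> forall A, measurable A ->
       (\int[pi]_x q t x A = pi A)%E) /\
    ereal_sup [set tv_dist (q t x) pi | x in setT] @[t --> +oo] --> 0%E.

End ergodicity.

(* Main.v *)
Require Import Defs.
From HB Require Import structures.
From mathcomp Require Import all_boot all_order all_algebra.
From mathcomp Require Import all_classical all_reals all_analysis measurable_realfun.
From mathcomp Require Import lra.

Set Implicit Arguments.
Unset Strict Implicit.
Unset Printing Implicit Defensive.

Import Order.TTheory GRing.Theory Num.Theory.
Import numFieldNormedType.Exports.

Local Open Scope classical_set_scope.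
Local Open Scope ring_scope.

(** Write Q x A for the law of X x (S t). Independence makes Q x a mixture of
the laws p s x, s distributed as S t. Each p s preserves pi, hence so does the
mixture; and p s x is within e of pi in total variation as soon as s
exceeds some level a, so Q x is within e + P (S t <= a) of pi, uniformly in x.
A subordinator that is not almost surely zero leaves every bounded interval in
probability ([subordinator_below_cvg0]), which gives uniform ergodicity.

The mixture is never written as an integral over s. The time S t is replaced by
the next point S_k of the grid of mesh 1/(k+1): the law of X x S_k is then a
countable sum of terms P (S_k = t_j) * p t_j x, for which invariance, the total
variation estimate and measurability in x are immediate; rounding up keeps the
times t_j positive, where the ergodicity assumption gives invariance. As S_k
tends to S t and paths are continuous, X x S_k tends to X x (S t) pointwise, and the portmanteau inequality
P (Y in U) <= liminf P (Y_k in U), U open, carries upper bounds by pi over to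
Q x on open sets ([law_open_le_limn_einf]). They extend to Borel sets because pi
is outer regular ([le_on_open_le_on_borel]). Passing to complements turns the
upper bounds into the equality and the two-sided estimate
([randomized_law_invariant], [randomized_law_close]). Measurability of Q in x
follows from a portmanteau sandwich, which recovers P (Y in U) as a limit over
an exhaustion of U ([law_open_cvg]). *)

(** * Outer regularity of Borel probability measures *)

Section borel_sets.
Context {R : realType} {T : normedModType R}.
Implicit Types (U : set T) (A : set (borel T)).

Lemma open_measurable_borel U : open U -> measurable (U : set (borel T)).
Proof. by move=> oU; exact: sub_sigma_algebra. Qed.

(** The m-th set is the interior of the set of points whose ball of radius
1/(m+1) lies in U. Having the closures inside U lets both portmanteau
inequalities be used on the same exhaustion. *)
Lemma open_exhaustion U : open U ->
  exists V : nat -> set T, [/\ forall m, open (V m),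
    forall m, closure (V m) `<=` U, nondecreasing_seq V & \bigcup_m V m = U].
Proof.
move=> oU; pose W m := [set y : T | ball y m.+1%:R^-1 `<=` U].
have WU m : W m `<=` U by move=> y; apply; apply: ballxx; rewrite invr_gt0.
exists (fun m => (W m)°); split.
- by move=> m; exact: open_interior.
- move=> m y /(_ (ball y m.+1%:R^-1)) [|z [/interior_subset Wz yz]].
    by apply: nbhsx_ballx; rewrite invr_gt0.
  by apply: Wz; exact: ball_sym.
- move=> m n mn; apply/subsetPset/interiorS => y Wy; apply: subset_trans Wy.
  by apply: le_ball; rewrite lef_pV2 ?posrE// ler_nat ltnS.
- apply/seteqP; split => [y [m _ /interior_subset]|y Uy]; first exact: WU.
  have /nbhs_ballP[e /= e0 yU] : nbhs y U by exact: open_nbhs_nbhs.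
  have e2 : 0 < e / 2 by rewrite divr_gt0.
  have [m _ /(_ m (leqnn m)) me] := near_infty_natSinv_lt (PosNum e2).
  exists m => //; apply/nbhs_ballP; exists (e / 2) => //= z yz w zw.
  apply: yU; rewrite [e]splitr; apply: ball_triangle yz _.
  by apply: le_ball zw; exact: ltW.
Qed.

Definition outer_approximable (mu : set (borel T) -> \bar R) A :=
  forall e : R, 0 < e ->
    exists U, [/\ open U, A `<=` U & (mu (U `\` A) <= e%:E)%E].

Variable mu : probability (borel T) R.

(** Continuity from above: an outer approximation by a countable intersection
of open sets can be traded for one by a single open set. *)
Lemma outer_approximable_bigcap (W : nat -> set T) A :
    (forall n, open (W n)) -> nonincreasing_seq W ->
    measurable A -> (forall n, A `<=` W n) ->
    forall e : R, (mu (\bigcap_n W n `\` A) < e%:E)%E ->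
  exists U, [/\ open U, A `<=` U & (mu (U `\` A) <= e%:E)%E].
Proof.
move=> oW niW mA AW e We.
have mW n : measurable (W n `\` A : set (borel T)).
  by apply: measurableD => //; exact: open_measurable_borel.
have capE : \bigcap_n (W n `\` A) = \bigcap_n W n `\` A.
  apply/seteqP; split => [y Wy|y [Wy nA] n _]; last by split => //; exact: Wy.
  by split => [n _|]; [have [] := Wy n I | have [] := Wy 0%N I].
have muW : mu (W n `\` A) @[n --> \oo] --> mu (\bigcap_n (W n `\` A)).
  apply: nonincreasing_cvg_mu => //.
  - by rewrite (le_lt_trans (probability_le1 _ _)) ?ltry.
  - exact: bigcapT_measurable.
  - move=> m n mn; apply/subsetPset; apply: setSD.
    exact/subsetPset/niW.
have [[n Wn]|WN] := pselect (exists n, (mu (W n `\` A) <= e%:E)%E).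
  by exists (W n); split.
have : (e%:E <= limn (fun n => mu (W n `\` A)))%E.
  apply: lime_ge; first by apply/cvg_ex; eexists; exact: muW.
  by apply: nearW => n; rewrite leNgt; apply/negP => /ltW Wn; apply: WN; exists n.
rewrite (cvg_lim _ muW)// capE => /le_lt_trans/(_ We).
by rewrite ltxx.
Qed.

Lemma outer_approximable_open U : open U -> outer_approximable mu U.
Proof.
move=> oU e e0; exists U; split => //.
by rewrite setDv measure0 lee_fin ltW.
Qed.

(** A closed set is the intersection of the complements of the closures of an
exhaustion of its complement. *)
Lemma outer_approximable_closed U : open U -> outer_approximable mu (~` U).
Proof.
move=> oU e e0; have [V [oV VU ndV UV]] := open_exhaustion oU.
apply: (@outer_approximable_bigcap (fun n => ~` closure (V n))).
- by move=> n; apply: closed_openC; exact: closed_closure.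
- move=> m n mn; apply/subsetPset; apply: subsetC; apply: closure_subset.
  exact/subsetPset/ndV.
- by apply: measurableC; exact: open_measurable_borel.
- by move=> n; apply: subsetC; exact: VU.
- rewrite (_ : _ `\` _ = set0) ?measure0 ?lte_fin//.
  apply/seteqP; split => // y [nVy /contrapT]; rewrite -UV => -[m _ Vy].
  by apply: (nVy m I); exact: subset_closure.
Qed.

Lemma outer_approximable_countable (A : nat -> set (borel T)) (e : R) : 0 < e ->
  (forall n, outer_approximable mu (A n)) ->
  exists U : nat -> set T, [/\ forall n, open (U n), forall n, A n `<=` U n &
    (\sum_(n <oo) mu (U n `\` A n) <= e%:E)%E].
Proof.
move=> e0 Aa.
have en n : 0 < e / (2 ^ n.+1)%:R by rewrite divr_gt0// ltr0n expn_gt0.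
have /choice[U UP] n := Aa n _ (en n).
exists U; split => [n|n|]; [by have [] := UP n|by have [] := UP n|].
apply: le_trans (epsilon_trick0 xpredT (ltW e0)).
by apply: lee_nneseries => // n _; have [] := UP n.
Qed.

(** The sets that are outer approximable together with their complement form
a sigma-algebra containing the open sets. *)
Lemma borel_outer_approximable A : measurable A -> outer_approximable mu A.
Proof.
pose G : set (set (borel T)) := [set A | [/\ measurable A,
  outer_approximable mu A & outer_approximable mu (~` A)]].
suff GE : measurable `<=` G by move=> /GE[].
apply: smallest_sub => [|U oU]; last first.
  split; [exact: open_measurable_borel|exact: outer_approximable_open|
          exact: outer_approximable_closed].
split.
- by split=> //; rewrite ?setC0; apply: outer_approximable_open;
    [exact: open0|exact: openT].
- by move=> B [mB Ba Bca]; rewrite setTD; split; [exact: measurableC| |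
    rewrite setCK].
move=> B GB; have mB n : measurable (B n : set (borel T)) by have [] := GB n.
have mcupB : measurable (\bigcup_n B n : set (borel T)) by exact: bigcupT_measurable.
split => // e e0.
- have [|U [oU BU Ue]] := @outer_approximable_countable B _ e0.
    by move=> n; have [] := GB n.
  exists (\bigcup_n U n); split; [exact: bigcup_open|exact: subset_bigcup|].
  apply: le_trans Ue; apply: measure_sigma_subadditive => //.
  + move=> n; apply: measurableD => //; exact: open_measurable_borel.
  + apply: measurableD => //; apply: open_measurable_borel; exact: bigcup_open.
  + move=> y [[n _ Uy] nBy]; exists n => //; split => // By; apply: nBy.
    by exists n.
- have e2 : 0 < e / 2 by rewrite divr_gt0.
  have [|U [oU BU Ue]] := @outer_approximable_countable (fun n => ~` B n) _ e2.
    by move=> n; have [] := GB n.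
  (* The intersection of all U i need not be open: use finite ones. *)
  apply: (@outer_approximable_bigcap (fun n => \bigcap_(i < n) U i)).
  + move=> n; rewrite bigcap_mkord; elim/big_ind: _ => [|? ?|i _].
    * exact: openT.
    * exact: openI.
    * exact: oU.
  + move=> m n mn; apply/subsetPset => y Uy i /= im.
    by apply: Uy; exact: leq_trans mn.
  + exact: measurableC.
  + move=> n; rewrite setC_bigcup => y By i _; apply: BU; exact: By.
  + apply: (@le_lt_trans _ _ (e / 2)%:E); last first.
      by rewrite lte_fin ltr_pdivrMr// ltr_pMr// ltr1n.
    apply: le_trans Ue; apply: measure_sigma_subadditive => //.
    * move=> n; apply: measurableD; last exact: measurableC.
      exact: open_measurable_borel.
    * apply: measurableD; last exact: measurableC.
      apply: bigcapT_measurable => n; apply: bigcap_measurableType => i _.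
      exact: open_measurable_borel.
    * move=> y [Uy /contrapT[n _ By]]; exists n => //; split; last by [].
      by apply: (Uy n.+1 I) => /=.
Qed.

(** Enlarge A to an open set of nearly the same measure under mu. Stating this
for a monotone set function [nu] covers both a single law and the integral of
a family of laws over its parameter. *)
Lemma le_on_open_le_on_borel (nu : set (borel T) -> \bar R) (c : \bar R) :
    (forall A B, measurable A -> measurable B -> A `<=` B -> nu A <= nu B)%E ->
    (forall U, open U -> nu U <= mu U + c)%E ->
  forall A, measurable A -> (nu A <= mu A + c)%E.
Proof.
move=> nu_mono nu_open A mA; apply/lee_addgt0Pr => e e0.
have [U [oU AU Ue]] := borel_outer_approximable mA e0.
have mU := open_measurable_borel oU.
apply: (@le_trans _ _ (nu U)); first exact: nu_mono.
apply: (le_trans (nu_open _ oU)); rewrite addeAC; apply: leeD => //.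
have mUA : measurable (U `\` A : set (borel T)) by exact: measurableD.
have -> : mu U = (mu A + mu (U `\` A))%E.
  rewrite -measureU//; last by rewrite setIC setDE -setIA setICl setI0.
  by rewrite setDUK.
exact: leeD.
Qed.

End borel_sets.

(** * Portmanteau inequalities for pointwise limits *)

Section limits_of_events.
Context d {Omega : measurableType d} {R : realType} (P : probability Omega R).
Implicit Types (E : nat -> set Omega) (A : set Omega).
Local Open Scope ereal_scope.

Lemma probability_le_limn_einf E A :
    (forall k, measurable (E k)) -> measurable A ->
    A `<=` \bigcup_n \bigcap_(k >= n) E k ->
  P A <= limn_einf (fun k => P (E k)).
Proof.
move=> mE mA AE; pose F n := \bigcap_(k >= n) E k.
have mF n : measurable (F n).
  by apply: bigcap_measurable => [|k _]; [exists n => /=|exact: mE].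
have mcupF : measurable (\bigcup_n F n) by exact: bigcupT_measurable.
have PF : P (F n) @[n --> \oo] --> P (\bigcup_n F n).
  apply: nondecreasing_cvg_mu => // m n mn.
  by apply/subsetPset => w Fw k /= nk; apply: Fw; exact: leq_trans nk.
apply: (@le_trans _ _ (P (\bigcup_n F n))); first by rewrite le_measure ?inE.
rewrite -(cvg_lim _ PF)// limn_einf_lim; apply: lee_lim.
- by apply/cvg_ex; eexists; exact: PF.
- exact: is_cvg_einfs.
- apply: nearW => n; apply: le_ereal_inf_tmp => _ [k /= nk <-].
  by rewrite le_measure ?inE// => w; exact.
Qed.

Lemma limn_esup_le_probability E A :
    (forall k, measurable (E k)) -> measurable A ->
    lim_sup_set E `<=` A ->
  limn_esup (fun k => P (E k)) <= P A.
Proof.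
move=> mE mA EA.
have PE : P (\bigcup_(k >= n) E k) @[n --> \oo] --> P (lim_sup_set E).
  apply: lim_sup_set_cvg => //; apply: le_lt_trans (ltry 1).
  by apply: probability_le1; exact: bigcup_measurable.
apply: (@le_trans _ _ (P (lim_sup_set E))); last first.
  rewrite le_measure ?inE//; apply: bigcapT_measurable => n.
  exact: bigcup_measurable.
rewrite -(cvg_lim _ PE)// limn_esup_lim; apply: lee_lim.
- exact: is_cvg_esups.
- by apply/cvg_ex; eexists; exact: PE.
- apply: nearW => n; apply: ge_ereal_sup => _ [k /= nk <-].
  rewrite le_measure ?inE//; first exact: bigcup_measurable.
  by move=> w Ew; exists k.
Qed.

End limits_of_events.

Section pointwise_limits.
Context d {Omega : measurableType d} {R : realType} {T : normedModType R}.
Variables (Y_ : nat -> Omega -> T) (Y : Omega -> T).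
Hypothesis cvgY : forall w, Y_ k w @[k --> \oo] --> Y w.

Lemma preimage_open_sub_liminf (U : set T) : open U ->
  Y @^-1` U `<=` \bigcup_n \bigcap_(k >= n) Y_ k @^-1` U.
Proof.
move=> oU w UY; have : nbhs (Y w) U by exact: open_nbhs_nbhs.
by move=> /cvgY[n _ nU]; exists n => // k /= nk; exact: nU.
Qed.

Lemma limsup_preimage_sub_closure (U : set T) :
  lim_sup_set (fun k => Y_ k @^-1` U) `<=` Y @^-1` closure U.
Proof.
move=> w Uw B /cvgY[n _ nB]; have [k /= nk Uk] := Uw n I.
by exists (Y_ k w); split => //; exact: nB.
Qed.

(** A limit of points of U may leave U, but a limit of points of V_m stays in
the closure of V_m, hence in U. *)
Lemma preimage_open_pointwise_limit (U : set T) (V : nat -> set T) :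
    (forall m, open (V m)) -> (forall m, closure (V m) `<=` U) ->
    \bigcup_m V m = U ->
  Y @^-1` U = \bigcup_m \bigcup_n \bigcap_(k >= n) Y_ k @^-1` V m.
Proof.
move=> oV VU UV; apply/seteqP; split => [w|w [m _ [n _ Vw]]].
  rewrite /= -{1}UV => -[m _ Vm]; exists m => //.
  exact: preimage_open_sub_liminf.
apply: (VU m); apply: limsup_preimage_sub_closure => i _.
exists (maxn i n); first exact: leq_maxl.
by apply: Vw; exact: leq_maxr.
Qed.

Hypothesis mY_ : forall k, measurable_fun setT (Y_ k : Omega -> borel T).

Let mY_preimage k (U : set T) : open U -> measurable (Y_ k @^-1` U).
Proof.
by move=> oU; rewrite -[X in measurable X]setTI; apply: mY_ => //;
   exact: open_measurable_borel.
Qed.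

Lemma measurable_pointwise_limit : measurable_fun setT (Y : Omega -> borel T).
Proof.
apply: (@measurability _ _ _ (borel T) _ _ (@open T)) => // _ [U oU <-].
rewrite setTI.
have [V [oV VU _ UV]] := open_exhaustion oU.
rewrite (preimage_open_pointwise_limit oV VU UV).
do 2! apply: bigcupT_measurable => ?.
apply: bigcap_measurableType => k _; exact: mY_preimage.
Qed.

Variable P : probability Omega R.
Local Open Scope ereal_scope.

Let mYU (U : set T) : measurable (U : set (borel T)) -> measurable (Y @^-1` U).
Proof.
move=> mU; rewrite -[X in measurable X]setTI.
exact: measurable_pointwise_limit.
Qed.

Lemma law_open_le_limn_einf (U : set T) : open U ->
  P (Y @^-1` U) <= limn_einf (fun k => P (Y_ k @^-1` U)).
Proof.
move=> oU; apply: probability_le_limn_einf.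
- by move=> k; exact: mY_preimage.
- by apply: mYU; exact: open_measurable_borel.
- exact: preimage_open_sub_liminf.
Qed.

(** The upper limit is squeezed between P (Y in V_m) and
P (Y in the closure of V_m), and the closure of V_m lies in U. *)
Lemma law_open_cvg (U : set T) (V : nat -> set T) :
    (forall m, open (V m)) -> (forall m, closure (V m) `<=` U) ->
    nondecreasing_seq V -> \bigcup_m V m = U ->
  limn_esup (fun k => P (Y_ k @^-1` V m)) @[m --> \oo] --> P (Y @^-1` U).
Proof.
move=> oV VU ndV UV.
have oU : open U by rewrite -UV; exact: bigcup_open.
have mV m : measurable (Y @^-1` V m) by apply: mYU; exact: open_measurable_borel.
have YU : Y @^-1` U = \bigcup_m Y @^-1` V m by rewrite -UV preimage_bigcup.
have PV : P (Y @^-1` V m) @[m --> \oo] --> P (Y @^-1` U).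
  rewrite YU; apply: nondecreasing_cvg_mu => //; first exact: bigcupT_measurable.
  by move=> m n mn; apply/subsetPset; apply: preimage_subset; exact/subsetPset/ndV.
apply: squeeze_cvge PV (cvg_cst _); apply: nearW => m; apply/andP; split.
  by apply: (le_trans (law_open_le_limn_einf (oV m))); exact: limn_einf_sup.
apply: limn_esup_le_probability => [k||]; first exact: mY_preimage.
  by apply: mYU; exact: open_measurable_borel.
apply: subset_trans (@limsup_preimage_sub_closure _) _.
by apply: preimage_subset; exact: VU.
Qed.

End pointwise_limits.

(** * Discretization of a random time *)

Section time_grid.
Context {R : realType}.
Implicit Types (k j : nat) (r : R).

Definition grid_cell k j : set R := [set r | j%:R <= k.+1%:R * r < j.+1%:R].

(** Right ends of the cells, so that the rounded time is positive. *)
Definition grid_point k j : R := j.+1%:R / k.+1%:R.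

Definition grid_index k r : nat := Num.truncn (k.+1%:R * r).

Lemma grid_point_gt0 k j : 0 < grid_point k j.
Proof. by rewrite divr_gt0. Qed.

Lemma grid_cell_lt k j r : grid_cell k j r -> r < grid_point k j.
Proof. by move=> /andP[_ rj]; rewrite ltr_pdivlMr// mulrC. Qed.

Lemma grid_cellE k j r : 0 <= r -> grid_cell k j r <-> grid_index k r = j.
Proof.
move=> r0; rewrite /grid_cell/= -truncn_eq ?mulr_ge0//.
by split => /eqP.
Qed.

Lemma measurable_grid_cell k j : measurable (grid_cell k j).
Proof.
rewrite (_ : grid_cell k j = `[j%:R / k.+1%:R, j.+1%:R / k.+1%:R[%classic)//.
apply/seteqP; split => r /=; rewrite in_itv/= ler_pdivrMr// ltr_pdivlMr//;
  by rewrite [r * _]mulrC.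
Qed.

Lemma trivIset_grid_cell k : trivIset setT (grid_cell k).
Proof.
move=> i j _ _ [r [/andP[ir ri] /andP[jr rj]]].
have := le_lt_trans ir rj; have := le_lt_trans jr ri.
rewrite !ltr_nat !ltnS => ji ij.
by apply/eqP; rewrite eqn_leq ij ji.
Qed.

Lemma grid_cvg r : 0 <= r ->
  grid_point k (grid_index k r) @[k --> \oo] --> r.
Proof.
move=> r0; apply/cvgrPdist_lt => e e0.
have [m _ me] := near_infty_natSinv_lt (PosNum e0).
exists m => // k /= mk; have := me k mk.
have /= cell : grid_cell k (grid_index k r) r by exact/grid_cellE.
rewrite ltr0_norm ?subr_lt0 ?grid_cell_lt// opprB.
apply: le_lt_trans.
rewrite lerBlDr addrC /grid_point -[(grid_index k r).+1%:R]natr1 mulrDl mul1r.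
by rewrite lerD2r ler_pdivrMr// mulrC; case/andP: cell.
Qed.

End time_grid.

Section random_index.
Context d {Omega : measurableType d} {R : realType} (P : probability Omega R).
Local Open Scope ereal_scope.

Lemma probability_trivIset_cover (N : nat -> set Omega) (E : set Omega) :
    (forall j, measurable (N j)) -> trivIset setT N -> \bigcup_j N j = setT ->
    measurable E ->
  P E = \sum_(j <oo) P (E `&` N j).
Proof.
move=> mN tN NT mE; rewrite -[in LHS](setIT E) -NT setI_bigcupr.
rewrite measure_bigcup//=.
- by under eq_eseriesl do rewrite in_setT.
- by move=> j _; exact: measurableI.
- exact: trivIset_setIl.
Qed.

End random_index.

(** * Evaluation of a process at an independent random time *)

Section fixed_time.
Context d {Omega : measurableType d} {R : realType} {T : normedModType R}.
Variables (P : probability Omega R) (pi : probability (borel T) R).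
Variable p : R -> R.-pker borel T ~> borel T.
Variables (X : T -> R -> Omega -> T) (tau : Omega -> R).

Definition randomized_law (x : T) (A : set (borel T)) : \bar R :=
  P [set w | A (X x (tau w) w)].

Local Notation Q := randomized_law.

Hypothesis X_cont : forall x w, {within `[0, +oo[, continuous (X x ^~ w)}.
Hypothesis X_meas : forall x (t : R), 0 <= t ->
  measurable_fun setT (X x t : Omega -> borel T).
Hypothesis X_law : forall x (t : R) (A : set (borel T)), 0 < t -> measurable A ->
  P (X x t @^-1` A) = p t x A.
Hypothesis tau_ge0 : forall w, 0 <= tau w.
Hypothesis tau_meas : measurable_fun setT tau.
Hypothesis X_tau_indep : forall x (t : R) (A : set (borel T)) (D : set R), 0 <= t ->
  measurable A -> measurable D ->
  P (X x t @^-1` A `&` tau @^-1` D) = (P (X x t @^-1` A) * P (tau @^-1` D))%E.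
Implicit Types (A : set (borel T)) (x : T) (k j : nat).
Local Open Scope ereal_scope.

(** The process at the time rounded up to the grid. *)
Let Y k x w : T := X x (grid_point k (grid_index k (tau w))) w.

Let Y_cvg x w : Y k x w @[k --> \oo] --> X x (tau w) w.
Proof.
have /subspace_continuousP Xc := X_cont (x := x) (w := w).
have t0 : `[0%R, +oo[%classic (tau w) by rewrite /= in_itv/= andbT.
apply: (@cvg_comp _ _ _ (fun k => grid_point k (grid_index k (tau w)))
  _ \oo _ _ _ (Xc _ t0)) => B.
move=> /(grid_cvg (tau_ge0 w)); apply: (@filterS _ \oo) => k; apply.
by rewrite /= in_itv/= andbT; rewrite ltW ?grid_point_gt0.
Qed.

Let cell k j : set Omega := tau @^-1` grid_cell k j.

Let measurable_tau (D : set R) : measurable D -> measurable (tau @^-1` D).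
Proof. by move=> mD; rewrite -[X in measurable X]setTI; exact: tau_meas. Qed.

Let measurable_cell k j : measurable (cell k j).
Proof. by apply: measurable_tau; exact: measurable_grid_cell. Qed.

Let trivIset_cell k : trivIset setT (cell k).
Proof.
move=> i j _ _ [w [iw jw]].
by apply: (@trivIset_grid_cell R k i j I I); exists (tau w).
Qed.

Let bigcup_cell k : \bigcup_j cell k j = setT.
Proof.
apply/seteqP; split => // w _; exists (grid_index k (tau w)) => //.
exact/grid_cellE.
Qed.

Let measurable_X x (t : R) A : (0 <= t)%R -> measurable A -> measurable (X x t @^-1` A).
Proof.
by move=> t0 mA; rewrite -[X in measurable X]setTI; exact: X_meas.
Qed.

(** On a cell the discretized time is deterministic, so the event becomes an
intersection to which independence applies. *)
Let Y_cell k x j A : Y k x @^-1` A `&` cell k j =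
  X x (grid_point k j) @^-1` A `&` cell k j.
Proof.
by apply/seteqP; split => w [Aw cw]; split => //; move: Aw;
  rewrite /Y /= (grid_cellE k j (tau_ge0 w)).1.
Qed.

Let measurable_Y k x : measurable_fun setT (Y k x : Omega -> borel T).
Proof.
move=> _ A mA; rewrite setTI -[X in measurable X]setIT -(bigcup_cell k).
rewrite setI_bigcupr; apply: bigcupT_measurable => j; rewrite Y_cell.
by apply: measurableI => //; apply: measurable_X => //; rewrite ltW ?grid_point_gt0.
Qed.

(** The discretized form of Bochner subordination. *)
Let law_Y k x A : measurable A ->
  P (Y k x @^-1` A) = \sum_(j <oo) P (cell k j) * p (grid_point k j) x A.
Proof.
move=> mA; rewrite (@probability_trivIset_cover _ _ _ _ (cell k))//.
  apply: eq_eseriesr => j _; rewrite Y_cell X_tau_indep//.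
  - by rewrite X_law ?grid_point_gt0// muleC.
  - by rewrite ltW ?grid_point_gt0.
  - exact: measurable_grid_cell.
by rewrite -[X in measurable X]setTI; exact: measurable_Y.
Qed.

Let sum_cell k : \sum_(j <oo) P (cell k j) = 1.
Proof.
rewrite -(@probability_setT _ _ _ P).
rewrite (@probability_trivIset_cover _ _ _ P (cell k) setT)//.
by under [RHS]eq_eseriesr do rewrite setTI.
Qed.


Let measurable_law_Y k A : measurable A ->
  measurable_fun setT (fun x : borel T => P (Y k x @^-1` A)).
Proof.
move=> mA; under eq_fun do rewrite law_Y//.
apply: ge0_emeasurable_sum => [j x _ _|j _].
  by rewrite mule_ge0.
by apply: emeasurable_funM => //; exact: measurable_kernel.
Qed.

Let measurable_Q_preimage x A : measurable A ->
  measurable [set w | A (X x (tau w) w)].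
Proof.
move=> mA; rewrite -[X in measurable X]setTI.
apply: (measurable_pointwise_limit (Y_cvg (x := x)) _ measurableT mA) => k.
exact: measurable_Y.
Qed.

(** Open sets are reached through the discretized laws, which are countable
mixtures of kernels; the others follow by Dynkin induction. *)
Lemma measurable_randomized_law A : measurable A ->
  measurable_fun setT (fun x : borel T => Q x A).
Proof.
move: A; apply: (@dynkin_induction _ (borel T) (@open T)) => //.
- by move=> U V oU oV; exact: openI.
- by rewrite /Q; apply: (eq_measurable_fun (cst 1)) => // x _; rewrite probability_setT.
- move=> U oU; have [V [oV VU ndV UV]] := open_exhaustion oU.
  apply: (@emeasurable_fun_cvg _ _ _ _
      (fun m (x : borel T) => limn_esup (fun k => P (Y k x @^-1` V m)))).
    move=> m; apply: measurable_fun_limn_esup => k.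
    by apply: measurable_law_Y; exact: open_measurable_borel.
  by move=> x _; exact: (law_open_cvg (Y_cvg (x := x)) (fun k => measurable_Y k x)).
- move=> A mA QA; apply: (eq_measurable_fun (fun x : borel T => 1 - Q x A)).
    by move=> x _; rewrite /Q -probability_setC//; exact: measurable_Q_preimage.
  exact: emeasurable_funB.
- move=> F mF tF QF.
  apply: (eq_measurable_fun (fun x : borel T => \sum_(n <oo) Q x (F n))).
    move=> x _; rewrite /Q.
    have mFk k := measurable_Q_preimage x (mF k).
    rewrite -measure_semi_bigcup//; last exact: bigcupT_measurable.
    move=> i j _ _ [w [iw jw]].
    by apply: (tF i j I I); exists (X x (tau w) w).
  exact: ge0_emeasurable_sum.
Qed.

Let randomized_law_open_le (U : set T) x (c : \bar R) : open U ->
  (forall k, P (Y k x @^-1` U) <= c) -> Q x U <= c.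
Proof.
move=> oU Yc; apply: (@le_trans _ _ (limn_einf (fun k => P (Y k x @^-1` U)))).
  exact: (law_open_le_limn_einf (Y_cvg (x := x)) (fun k => measurable_Y k x)).
rewrite limn_einf_lim; apply: lime_le; first exact: is_cvg_einfs.
apply: nearW => n; apply: le_trans (Yc n).
by apply: ereal_inf_lbound; exists n => /=.
Qed.

Hypothesis pi_invariant : forall t A, (0 < t)%R -> measurable A ->
  \int[pi]_x p t x A = pi A.

Let integral_law_Y k A : measurable A -> \int[pi]_x P (Y k x @^-1` A) = pi A.
Proof.
move=> mA; under eq_integral do rewrite law_Y//.
rewrite integral_nneseries//=; last 2 first.
- by move=> j; apply: emeasurable_funM => //; exact: measurable_kernel.
- by move=> j x _; rewrite mule_ge0.
under eq_eseriesr => j _.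
  rewrite ge0_integralZl//=; last exact: measurable_kernel.
  rewrite pi_invariant ?grid_point_gt0// muleC -(fineK (fin_num_measure _ _ mA)).
  over.
by rewrite nneseriesZl// sum_cell mule1 fineK// fin_num_measure.
Qed.

(** The bound by pi on open sets is Fatou's lemma in x applied to the
portmanteau inequality. Two probability measures, one below the other, are
equal; this is the passage to complements. *)
Lemma randomized_law_invariant A : measurable A -> \int[pi]_x Q x A = pi A.
Proof.
have le A' : measurable A' -> \int[pi]_x Q x A' <= pi A'.
  move=> mA'; rewrite -[leRHS]adde0.
  apply: (@le_on_open_le_on_borel _ _ pi (fun A => \int[pi]_x Q x A)) => //.
    move=> B C mB mC BC; apply: ge0_le_integral => //.
    - exact: measurable_randomized_law.
    - exact: measurable_randomized_law.
    - move=> x _; rewrite le_measure ?inE//; [exact: measurable_Q_preimage..|].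
      by move=> w; exact: BC.
  move=> U oU; have mU := open_measurable_borel oU.
  rewrite adde0.
  apply: (@le_trans _ _ (\int[pi]_x limn_einf (fun k => P (Y k x @^-1` U)))).
    apply: ge0_le_integral => //.
    - exact: measurable_randomized_law.
    - apply: measurableT_comp => //; apply: measurable_fun_limn_esup => k.
      by apply: measurableT_comp => //; exact: measurable_law_Y.
    - move=> x _.
      exact: (law_open_le_limn_einf (Y_cvg (x := x)) (fun k => measurable_Y k x)).
  apply: le_trans (fatou _ _ _ _) _ => //.
    by move=> k; exact: measurable_law_Y.
  by under eq_fun do rewrite integral_law_Y//; rewrite (cvg_limn_einf_sup (cvg_cst _)).1.
move=> mA; apply/eqP; rewrite eq_le le//=.
have := le _ (measurableC mA).
have QC x : Q x (~` A) = 1 - Q x A.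
  by rewrite /Q -probability_setC//; exact: measurable_Q_preimage.
have intQ_fin : \int[pi]_x Q x A \is a fin_num.
  rewrite ge0_fin_numE ?integral_ge0//; apply: le_lt_trans (le _ mA) _.
  by rewrite (le_lt_trans (probability_le1 _ _)) ?ltry.
rewrite -(leeD2lE _ _ intQ_fin) -ge0_integralD//; last 2 first.
- exact: measurable_randomized_law.
- by apply: measurable_randomized_law; exact: measurableC.
have Qfin x : Q x A \is a fin_num.
  by rewrite fin_num_measure//; exact: measurable_Q_preimage.
under eq_integral do rewrite QC addeC subeK//.
rewrite integral_cst//= mul1e.
have mcA := measurableC mA.
have -> : pi setT = pi A + pi (~` A) by rewrite -measureU ?setICr// setUv.
by rewrite leeD2rE// fin_num_measure.
Qed.

(** Cells ending after s contribute at most pi A + e times their probability;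
the others lie in the event that tau is at most s, and there p is bounded
by 1. *)
Lemma randomized_law_close (s e : R) : (0 <= e)%R ->
    (forall t x A, (s < t)%R -> measurable A -> p t x A <= pi A + e%:E) ->
  forall x A, measurable A ->
    `| Q x A - pi A | <= e%:E + P (tau @^-1` `]-oo, s]).
Proof.
move=> e0 p_close x.
pose early := tau @^-1` `]-oo, s].
have mearly : measurable early by apply: measurable_tau.
have Y_close k A : measurable A ->
    P (Y k x @^-1` A) <= pi A + (e%:E + P early).
  move=> mA; rewrite law_Y//.
  pose c := fine (pi A + e%:E).
  have cE : c%:E = pi A + e%:E.
    by rewrite fineK// fin_numD fin_num_measure.
  have c0 : 0 <= c%:E by rewrite cE adde_ge0// lee_fin.
  rewrite addeA -cE (@probability_trivIset_cover _ _ _ P (cell k) early)//.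
  rewrite -[c%:E]mule1 -(sum_cell k) -nneseriesZl// -nneseriesD//; last first.
    by move=> j _ _; rewrite mule_ge0.
  apply: lee_nneseries => [j _ _|j _]; first by rewrite mule_ge0.
  (* Late cells are absorbed by the first summand, early ones by the second. *)
  have [st|ts] := ltP s (grid_point k j).
    apply: (@le_trans _ _ (c%:E * P (cell k j))); last by rewrite leeDl.
    by rewrite muleC lee_wpmul2r// cE p_close.
  rewrite setIC (_ : cell k j `&` early = cell k j); last first.
    apply: setIidl => w /grid_cell_lt jw.
    by rewrite /early/= in_itv/= (le_trans (ltW jw)).
  apply: (@le_trans _ _ (P (cell k j))); last by rewrite leeDr// mule_ge0.
  rewrite -[leRHS]mule1 lee_wpmul2l// -X_law ?grid_point_gt0//.
  by apply/probability_le1/measurable_X => //; rewrite ltW ?grid_point_gt0.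
have Q_close A : measurable A -> Q x A <= pi A + (e%:E + P early).
  move: A; apply: le_on_open_le_on_borel => [A B mA mB AB|U oU].
    rewrite le_measure ?inE//; [exact: measurable_Q_preimage..|].
    by move=> w; exact: AB.
  apply: randomized_law_open_le => // k.
  by apply: Y_close; exact: open_measurable_borel.
move=> A mA; have := Q_close _ mA; have := Q_close _ (measurableC mA).
rewrite probability_setC//.
have -> : Q x (~` A) = 1 - Q x A.
  by rewrite /Q -probability_setC//; exact: measurable_Q_preimage.
have : Q x A \is a fin_num by rewrite fin_num_measure//; exact: measurable_Q_preimage.
have : pi A \is a fin_num by rewrite fin_num_measure.
have : P early \is a fin_num by rewrite fin_num_measure.
move: (Q x A) (pi A) (P early) => [q| |]// [a| |]// [l| |]// _ _ _.
rewrite -!(EFinB, EFinD) !lee_fin ler_norml => h1 h2.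
by apply/andP; split; lra.
Qed.

End fixed_time.

(** * Escape of subordinators to infinity *)

Section subordinator_escape.
Context d {Omega : measurableType d} {R : realType} (P : probability Omega R).
Variable S : R -> Omega -> R.
Hypotheses (hS : subordinator P S) (hS0 : nonzero_process P S).
Implicit Types (r s t a b : R).
Local Open Scope ereal_scope.

Let measurable_S t (D : set R) : (0 <= t)%R -> measurable D ->
  measurable (S t @^-1` D).
Proof. by move=> t0 mD; rewrite -[X in measurable X]setTI; exact: (sub_meas hS t0). Qed.

Let measurable_incr r t (D : set R) : (0 <= r)%R -> (0 <= t)%R ->
  measurable D -> measurable [set w | D (S (r + t) w - S r w)%R].
Proof.
move=> r0 t0 mD; rewrite -[X in measurable X]setTI.
suff mf : measurable_fun setT (fun w => S (r + t) w - S r w)%R by exact: mf.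
by apply: measurable_funB; apply: sub_meas hS _ _ => //; exact: addr_ge0.
Qed.

Lemma subordinator_split r t (C D : set R) : (0 <= r)%R -> (0 <= t)%R ->
    measurable C -> measurable D ->
  P ([set w | C (S r w)] `&` [set w | D (S (r + t) w - S r w)%R]) =
  P [set w | C (S r w)] * P [set w | D (S t w)].
Proof.
move=> r0 t0 mC mD; rewrite -(sub_stationary hS r0 t0 mD).
apply: (sub_indep hS r0 (t := (r + t)%R)).
- by rewrite lerDl.
- apply: sub_sigma_algebra; exists r, C; split => //.
  by rewrite /= r0 lexx.
- by exists D => //; rewrite setTI.
Qed.

Let above a t := P [set w | (a <= S t w)%R].
Let below a t := P [set w | (S t w <= a)%R].

Let measurable_le a : measurable [set x : R | (x <= a)%R].
Proof. by rewrite (_ : [set x | _] = `]-oo, a]%classic). Qed.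

Let measurable_ge a : measurable [set x : R | (a <= x)%R].
Proof.
rewrite (_ : [set x | _] = `[a, +oo[%classic)//.
by apply/seteqP; split => x /=; rewrite in_itv/= andbT.
Qed.

Let measurable_above a t : (0 <= t)%R -> measurable [set w | (a <= S t w)%R].
Proof. by move=> t0; exact: (measurable_S t0 (measurable_ge a)). Qed.

Let measurable_below a t : (0 <= t)%R -> measurable [set w | (S t w <= a)%R].
Proof. by move=> t0; exact: (measurable_S t0 (measurable_le a)). Qed.

(** Two successive independent increments above a and b bring the process
above a + b. *)
Let above_mul a b r t : (0 <= r)%R -> (0 <= t)%R ->
  above a r * above b t <= above (a + b)%R (r + t)%R.
Proof.
move=> r0 t0; have rt0 : (0 <= r + t)%R by exact: addr_ge0.
have -> := esym (subordinator_split r0 t0 (measurable_ge a) (measurable_ge b)).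
apply: le_measure; rewrite ?inE.
- apply: measurableI; first exact: measurable_above.
  exact: (measurable_incr r0 t0 (measurable_ge b)).
- exact: measurable_above.
- by move=> w /= [ar bt]; lra.
Qed.

(** Some S t exceeds some e > 0 with positive probability; iterating this n
times with e * n >= a reaches the level a. *)
Let above_gt0 a : exists2 t : R, (0 <= t)%R & 0 < above a t.
Proof.
have [t t0 St_neq0] := hS0.
have [e e0 et] : exists2 e : R, (0 < e)%R & 0 < above e t.
  apply: contrapT => /forall2NP noe; apply: St_neq0.
  have : P.-negligible (\bigcup_n [set w | (n.+1%:R^-1 <= S t w)%R]).
    apply: negligible_bigcup => n.
    exists [set w | (n.+1%:R^-1 <= S t w)%R]; split => //.
      exact: measurable_above.
    have [/negP|/negP] := noe (n.+1%:R^-1)%R; first by rewrite invr_gt0 ltr0n.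
    by rewrite -leNgt => le0; apply/eqP; rewrite eq_le le0 measure_ge0.
  apply: (negligibleS _) => w /= Sw; have S0 : (0 < S t w)%R.
    by rewrite lt_neqAle eq_sym (sub_ge0 hS)// andbT; apply/eqP.
  have [n _ /(_ n (leqnn n)) ne] := near_infty_natSinv_lt (PosNum S0).
  by exists n => //=; exact: ltW.
have [n an] : exists n : nat, (a <= e * n%:R)%R.
  exists (Num.truncn (a / e)).+1; rewrite mulrC -ler_pdivrMr//.
  by apply/ltW; exact: truncnS_gt.
exists (t * n%:R)%R; first by rewrite mulr_ge0.
apply: (@lt_le_trans _ _ (above (e * n%:R)%R (t * n%:R)%R)); last first.
  apply: le_measure; rewrite ?inE; [apply: measurable_above => //; exact: mulr_ge0..|].
  by move=> w /=; exact: le_trans.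
elim: n {an} => [|n IH].
  rewrite !mulr0 /above (_ : [set w | _] = setT) ?probability_setT//.
  by apply/seteqP; split => // w _ /=; exact: (sub_ge0 hS).
rewrite -natr1 !mulrDr !mulr1; apply: lt_le_trans (above_mul _ _ _ _) => //.
  exact: mule_gt0.
by rewrite mulr_ge0.
Qed.

(** Staying below a over the time r + t forces both S r and the next increment
to be at most a, up to the null event that the increment is negative: it has
the law of a nonnegative variable. *)
Let below_mul a r t : (0 <= r)%R -> (0 <= t)%R ->
  below a (r + t) <= below a r * below a t.
Proof.
move=> r0 t0; have rt0 : (0 <= r + t)%R by exact: addr_ge0.
have -> := esym (subordinator_split r0 t0 (measurable_le a) (measurable_le a)).
have mneg : measurable [set x : R | (x < 0)%R].
  by rewrite (_ : [set x | _] = `]-oo, 0%R[%classic).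
set E := _ `&` _.
pose N := [set w | (S (r + t) w - S r w < 0)%R].
have N0 : P N = 0.
  rewrite [LHS](sub_stationary hS r0 t0 mneg) (_ : [set w | _] = set0) ?measure0//.
  by apply/seteqP; split => // w /=; rewrite ltNge (sub_ge0 hS).
have mE : measurable E.
  apply: measurableI; first exact: measurable_below.
  exact: (measurable_incr r0 t0 (measurable_le a)).
have mN : measurable N by exact: (measurable_incr r0 t0 mneg).
rewrite -[leRHS]adde0 -[X in _ + X]N0; apply: le_trans (measureU2 _ _ _) => //.
apply: le_measure; rewrite ?inE; [exact: measurable_below|exact: measurableU|].
move=> w /= aw; have := sub_ge0 hS w r0.
have [Nw _|/negP Nw S0] := pselect (N w); first by right.
by left; split => /=; move: Nw; rewrite /N/= -leNgt; lra.
Qed.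

(** For t with P (S t >= a + 1) > 0, the probability q that S t is at most a is
less than 1, and submultiplicativity bounds the probability at time t * n by
q ^+ n. *)
Lemma subordinator_below_cvg0 (a e : R) : (0 < e)%R ->
  exists M : R, forall t, (M < t)%R -> P [set w | (S t w <= a)%R] <= e%:E.
Proof.
move=> e0; have [t t0 at0] := above_gt0 (a + 1).
have bfin s : (0 <= s)%R -> below a s \is a fin_num.
  by move=> s0; apply: fin_num_measure; exact: measurable_below.
pose q := fine (below a t).
have qE : q%:E = below a t by rewrite fineK// bfin.
have q0 : (0 <= q)%R by rewrite -lee_fin qE.
have q1 : (q < 1)%R.
  have mab := measurable_above (a + 1) t0.
  rewrite -lte_fin qE; apply: (@le_lt_trans _ _ (1 - above (a + 1) t)).
    rewrite -probability_setC//; apply: le_measure; rewrite ?inE.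
    - exact: measurable_below.
    - exact: measurableC.
    - by move=> w /= wa; apply/negP; rewrite -ltNge; lra.
  by rewrite lteBlDr ?lteDl// fin_num_measure.
have bq n : below a (t * n%:R) <= (q ^+ n)%:E.
  elim: n => [|n IH].
    by apply: probability_le1; apply: measurable_below => //; rewrite mulr0.
  rewrite -natr1 mulrDr mulr1; apply: le_trans (below_mul _ _ _) _ => //.
    by rewrite mulr_ge0.
  rewrite exprSr EFinM qE; exact: lee_wpmul2r.
have [n _ /(_ n (leqnn n))] : \forall n \near \oo, (q ^+ n < e)%R.
  have /cvgr0_norm_lt/(_ e e0) : (q ^+ n @[n --> \oo] --> (0:R))%R.
    by apply: cvg_expr; rewrite ger0_norm.
  by apply: filterS => n; apply: le_lt_trans; exact: ler_norm.
move=> qn; exists (t * n%:R)%R => s ns.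
have -> : s = (t * n%:R + (s - t * n%:R))%R by rewrite addrC subrK.
apply: le_trans (below_mul _ _ _) _.
- by rewrite mulr_ge0.
- by rewrite subr_ge0 ltW.
- apply: (@le_trans _ _ (below a (t * n%:R) * 1)).
    rewrite lee_wpmul2l//; apply: probability_le1; apply: measurable_below => //.
    by rewrite subr_ge0 ltW.
  by rewrite mule1 (le_trans (bq n))// lee_fin ltW.
Qed.

End subordinator_escape.

(** * Uniform ergodicity *)

Section uniform_ergodicity.
Context {R : realType} {d : nat}.
Variables (q : R -> borel 'cV[R]_d -> set (borel 'cV[R]_d) -> \bar R)
  (pi : probability (borel 'cV[R]_d) R).
Local Open Scope ereal_scope.

Definition worst_tv (t : R) : \bar R := ereal_sup [set tv_dist (q t x) pi | x in setT].

Let worst_tv_ge t x A : measurable A -> `|q t x A - pi A| <= worst_tv t.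
Proof.
move=> mA; apply: (@le_trans _ _ (tv_dist (q t x) pi)).
  by apply: ereal_sup_ubound; exists A.
by apply: ereal_sup_ubound; exists x.
Qed.

Let worst_tv_ge0 t : 0 <= worst_tv t.
Proof. exact: le_trans (worst_tv_ge t 0%R measurable0). Qed.

Lemma worst_tv_cvg0P :
  worst_tv t @[t --> +oo%R] --> 0 <->
  forall e : R, (0 < e)%R -> exists M : R, forall t, (M < t)%R ->
    forall x A, measurable A -> `|q t x A - pi A| <= e%:E.
Proof.
split=> [/fine_cvgP[q_fin /cvgr0_norm_le q_cvg] e e0|q_le].
  have [M [_ Mq]] : \forall t \near +oo%R, worst_tv t <= e%:E.
    near=> t; rewrite -[leLHS]fineK; last by near: t.
    rewrite lee_fin (le_trans (ler_norm _))//.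
    by near: t; exact: q_cvg.
  exists M => t Mt x A mA; exact: le_trans (worst_tv_ge t x mA) (Mq _ Mt).
have worst_le e : (0 < e)%R -> \forall t \near +oo%R, worst_tv t <= e%:E.
  move=> /q_le[M Mq]; exists M; split; first exact: num_real.
  move=> t Mt; apply: ge_ereal_sup => _ [x _ <-].
  by apply: ge_ereal_sup => _ [A mA <-]; exact: Mq.
have q_fin : \forall t \near +oo%R, worst_tv t \is a fin_num.
  near=> t; rewrite ge0_fin_numE//; apply: le_lt_trans (ltry 1).
  by near: t; exact: worst_le.
apply/fine_cvgP; split => //; apply/cvgr0Pnorm_le => e e0.
near=> t; rewrite ger0_norm ?fine_ge0// -lee_fin fineK; last by near: t.
by near: t; exact: worst_le.
Unshelve. all: by end_near. Qed.

End uniform_ergodicity.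

Theorem mainTheorem3 (R : realType) (d n : nat) (hd : (0 < d)%N)
    (b : 'cV[R]_d -> 'cV[R]_d) (sigma : 'cV[R]_d -> 'M[R]_(d, n))
    (x0 : 'cV[R]_d) (r0 : R)
    (hA1 : condA1 b sigma) (hA2 : condA2 b sigma) (hA3 : condA3 b sigma)
    (hA4 : condA4 b sigma x0 r0) (hA5 : condA5 sigma x0 r0)
    (disp : measure_display) (Omega : measurableType disp)
    (P : probability Omega R) (F : R -> set (set Omega))
    (hF : usual_filtration P F)
    (B : R -> Omega -> 'cV[R]_n) (hB : brownian_motion P F B)
    (X : 'cV[R]_d -> R -> Omega -> 'cV[R]_d)
    (hX : forall x : 'cV[R]_d, sde_solution P F B b sigma x (X x))
    (p : R -> R.-pker borel 'cV[R]_d ~> borel 'cV[R]_d)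
    (hp : forall (t : R) (x : 'cV[R]_d) (A : set (borel 'cV[R]_d)),
        0 <= t -> measurable A -> p t x A = process_kernel P X t x A)
    (herg : uniformly_ergodic (fun t x A => p t x A))
    (S : R -> Omega -> R) (hS : subordinator P S) (hS0 : nonzero_process P S)
    (hXS : forall x : 'cV[R]_d,
        indep_processes P (X x : R -> Omega -> borel 'cV[R]_d) S) :
  uniformly_ergodic (process_kernel P (subordinate X S)).
Proof.
have [pi [pi_inv pi_tv]] := herg; exists pi.
have X_meas x (t : R) : 0 <= t -> measurable_fun setT (X x t : Omega -> borel 'cV[R]_d).
  move=> t0 _ A mA; rewrite setTI; apply: (filtration_sub hF t0).
  exact: (sol_adapted (hX x)).
have X_law x (t : R) (A : set (borel 'cV[R]_d)) : 0 < t -> measurable A ->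
    P (X x t @^-1` A) = p t x A.
  by move=> /ltW t0 mA; rewrite hp.
have indep (s : R) : 0 <= s -> forall x (t : R) (A : set (borel 'cV[R]_d)) (D : set R),
    0 <= t -> measurable A -> measurable D ->
    P (X x t @^-1` A `&` S s @^-1` D) = (P (X x t @^-1` A) * P (S s @^-1` D))%E.
  move=> s0 x t A D t0 mA mD; apply: (hXS x); apply: sub_sigma_algebra.
    by exists t, A.
  by exists s, D.
split=> [t /ltW t0 A mA|].
  apply: (@randomized_law_invariant _ Omega R 'cV[R]_d P pi p X (S t)) => //.
  - by move=> x w; exact: (sol_cont (hX x)).
  - by move=> w; exact: (sub_ge0 hS).
  - exact: (sub_meas hS t0).
  - exact: indep.
  - by move=> u C u0 mC; exact: pi_inv.
apply: (worst_tv_cvg0P (process_kernel P (subordinate X S)) pi).2 => e e0.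
have e2 : 0 < e / 2 by rewrite divr_gt0.
have [s ps] := (worst_tv_cvg0P (fun t x A => p t x A) pi).1 pi_tv _ e2.
have [M PM] := subordinator_below_cvg0 hS hS0 s e2.
exists (Num.max 0 M) => t; rewrite gt_max => /andP[/ltW t0 Mt] x A mA.
have -> : e%:E = ((e / 2)%:E + (e / 2)%:E)%E by rewrite -EFinD -splitr.
have tv_le : (`|randomized_law P X (S t) x A - pi A| <=
    (e / 2)%:E + P (S t @^-1` `]-oo, s]))%E.
  apply: (@randomized_law_close _ Omega R 'cV[R]_d P pi p X (S t)) => //.
  - by move=> y w; exact: (sol_cont (hX y)).
  - by move=> w; exact: (sub_ge0 hS).
  - exact: (sub_meas hS t0).
  - exact: indep.
  - exact: ltW.
  move=> r y C sr mC; rewrite -leeBlDl ?fin_num_measure//.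
  by apply: le_trans (ps r sr y C mC); exact: lee_abs.
apply: le_trans tv_le _; apply: leeD => //.
exact: PM.
Qed.
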